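(* Let $U,W$ be real Hilbert spaces and consider the problem $\min_{u\in U} f(u)+\lambda\,(g(Lu)+h(u))$, $\lambda>0$, where $L\colon U\to W$ is a bounded linear operator, $f\colon U\to\mathbb{R}$ is convex and differentiable with $\beta$-Lipschitz continuous gradient for some $\beta>0$, $g$ and $h$ are convex, proper, lower semi-continuous functions with values in $\mathbb{R}\cup\{+\infty\}$ such that $g\circ L+h$ is proper, the problem admits at least one solution for every $\lambda>0$, and $\lambda h=h$ for every $\lambda>0$. Consider a single Condat-Vu (CV) iteration, i.e. the map $(u_k,w_k)\mapsto(u_{k+1},w_{k+1})$, $$u_{k+1}=\mathrm{prox}_{\gamma\lambda h}\big(u_k-\gamma L^*w_k-\gamma\nabla f(u_k)\big),\qquad w_{k+1}=\mathrm{prox}_{\sigma(\lambda g)^*}(c_2),\quad c_2=w_k+\sigma L u_{k+1},$$ with step sizes $\gamma,\sigma>0$ not depending on $\lambda$. Then the sensitivity of this single iteration with respect to $\lambda$ (the input $(u_k,w_k)$ being held fixed) is $$\frac{\partial w_{k+1}}{\partial\lambda}=\frac{\partial}{\partial\lambda}\,\mathrm{prox}_{\sigma(\lambda g)^*}(c_2),$$ where on the right-hand side $c_2$ is held constant, provided that this derivative exists for almost all $\lambda>0$. In particular, for $g=\|\cdot\|_{2,1}$ one has $\mathrm{prox}_{\sigma(\lambda g)^*}=\Pi_\lambda$ and, for every $w\in W$ and component-wise for almost all $\lambda>0$, $$\frac{\partial}{\partial\lambda}\Pi_\lambda(w)=\frac{w\,|w|_2}{\lambda^2\max^2\{1,\lambda^{-1}|w|_2\}}\,H\big(\lambda^{-1}|w|_2-1\big),$$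 with all operations understood component-wise.
   Context: For a convex, proper, lower semi-continuous function $\phi$ on a Hilbert space, $\mathrm{prox}_\phi(u)=\mathrm{arg\,min}_{w}\{\tfrac12\|u-w\|^2+\phi(w)\}$, and $\phi^*(u)=\sup_w\{\langle u,w\rangle-\phi(w)\}$ is the Legendre–Fenchel conjugate. $L^*$ is the adjoint of $L$, and $\nabla f$ is the gradient of $f$. In the particular case $g=\|\cdot\|_{2,1}$, $U$ is the finite-dimensional Euclidean space of discretized 3D images and $W=U\times U\times U$, so that an element $w\in W$ has at each voxel a component in $\mathbb{R}^3$; $|w|_2$ is the component-wise (voxel-wise) Euclidean norm, $\|w\|_{2,1}=\||w|_2\|_1$, and $\|w\|_{2,\infty}=\||w|_2\|_\infty$. $\Pi_\lambda$ is the projection onto the 2-balls of radius $\lambda$ (onto $\{\|\cdot\|_{2,\infty}\le\lambda\}$), given component-wise by $\Pi_\lambda(w)=w/\max\{1,\lambda^{-1}|w|_2\}$. $H$ is the Heaviside step function: $H(s)=0$ for $s<0$ and $H(s)=1$ for $s>0$ (the value at $s=0$ is immaterial here, as it concerns at most one value of $\lambda$ per component). *)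

(* Defs.v *)
From HB Require Import structures.
From mathcomp Require Import all_boot all_order all_algebra.
From mathcomp Require Import all_classical all_reals all_analysis.
From mathcomp Require Import ring lra.

Set Implicit Arguments.
Unset Strict Implicit.
Unset Printing Implicit Defensive.

Import Order.TTheory GRing.Theory Num.Theory.
Import numFieldNormedType.Exports.

Local Open Scope classical_set_scope.
Local Open Scope ring_scope.

(* The norm, hence the topology used for differentiability, is the one
   induced by the inner product ([hdotxx]). *)
HB.mixin Record CompleteNormedModule_isHilbert (R : realType) V
    of CompleteNormedModule R V := {
  hdot : V -> V -> R;
  hdotC : forall x y, hdot x y = hdot y x;
  hdotDl : forall x y z, hdot (x + y) z = hdot x z + hdot y z;
  hdotZl : forall a x y, hdot (a *: x) y = a * hdot x y;
  hdotxx : forall x, hdot x x = `|x| ^+ 2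
}.

#[short(type="hilbertType")]
HB.structure Definition Hilbert (R : realType) :=
  {V of CompleteNormedModule_isHilbert R V & CompleteNormedModule R V}.

Section convex_analysis.
Context {R : realType}.
Local Open Scope ereal_scope.

Definition eproper {V : Type} (phi : V -> \bar R) :=
  (forall x, phi x != -oo) /\ exists x, phi x < +oo.

(* [0 * +oo = 0], so the endpoints t = 0, 1 impose nothing. *)
Definition econvex {V : lmodType R} (phi : V -> \bar R) :=
  forall (t : R) (x y : V), (0 <= t <= 1)%R ->
    phi (t *: x + (1 - t) *: y)%R <= t%:E * phi x + (1 - t)%:E * phi y.

Definition Gamma0 {V : hilbertType R} (phi : V -> \bar R) :=
  [/\ econvex phi, eproper phi & lower_semicontinuous phi].

Definition escale {V : Type} (c : R) (phi : V -> \bar R) : V -> \bar R :=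
  fun x => c%:E * phi x.

Definition is_argmin {V : Type} (phi : V -> \bar R) (x : V) :=
  forall y, phi x <= phi y.

(* The argmin is unique for convex proper lsc [phi]; [0] is a default value
   when there is no minimizer. *)
Definition prox {V : hilbertType R} (phi : V -> \bar R) (u : V) : V :=
  xget 0%R (is_argmin (fun w => (2^-1 * `|u - w| ^+ 2)%:E + phi w)).

Definition fenchel {V : hilbertType R} (phi : V -> \bar R) (u : V) : \bar R :=
  ereal_sup [set (hdot u w)%:E - phi w | w in [set: V]].

End convex_analysis.

Section condat_vu.
Context {R : realType} {U W : hilbertType R}.

(* By Riesz, [adjoint L w] and [gradient f u] are the unique elements of the
   respective sets as soon as [L] is bounded linear and [f] is differentiable
   at [u]. *)
Definition adjoint (L : U -> W) (w : W) : U :=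
  xget 0 [set v | forall u, hdot (L u) w = hdot u v].

Definition gradient (f : U -> R^o) (u : U) : U :=
  xget 0 [set v | forall d, 'd f u d = hdot v d].

Definition bounded_operator (L : U -> W) :=
  exists M : R, forall u, `|L u| <= M * `|u|.

Variables (f : U -> R^o) (g : W -> \bar R) (h : U -> \bar R) (L : U -> W).
Variables (gam sig : R).

Definition objective (lam : R) (u : U) : \bar R :=
  ((f u)%:E + lam%:E * (g (L u) + h u))%E.

Definition cv_primal (lam : R) (p : U * W) : U :=
  prox (escale (gam * lam) h)
    (p.1 - gam *: adjoint L p.2 - gam *: gradient f p.1).

Definition cv_c2 (lam : R) (p : U * W) : W :=
  p.2 + sig *: L (cv_primal lam p).

Definition dual_prox (lam : R) (c : W) : W :=
  prox (escale sig (fenchel (escale lam g))) c.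

Definition cv_step (lam : R) (p : U * W) : U * W :=
  (cv_primal lam p, dual_prox lam (cv_c2 lam p)).

End condat_vu.

(* The alias keeps the Euclidean norm apart from any structure on the
   underlying function type. *)
Definition euclid (R : realType) (I : finType) : Type := {ffun I -> R^o}.

Section euclid.
Context {R : realType} {I : finType}.
Local Notation E := (euclid R I).

HB.instance Definition _ := GRing.Lmodule.on E.

Implicit Types x y z : E.

Definition ecoord (x : E) (i : I) : R := (x : {ffun I -> R^o}) i.

Definition edot x y : R := \sum_i ecoord x i * ecoord y i.
Definition enorm x : R := Num.sqrt (edot x x).

Lemma ecoordD x y i : ecoord (x + y) i = ecoord x i + ecoord y i.
Proof. by rewrite /ecoord ffunE. Qed.

Lemma ecoordZ a x i : ecoord (a *: x) i = a * ecoord x i.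
Proof. by rewrite /ecoord ffunE. Qed.

Lemma ecoordB x y i : ecoord (x - y) i = ecoord x i - ecoord y i.
Proof. by rewrite /ecoord !ffunE. Qed.

Lemma edotC x y : edot x y = edot y x.
Proof. by apply: eq_bigr => i _; rewrite mulrC. Qed.

Lemma edotDl x y z : edot (x + y) z = edot x z + edot y z.
Proof.
by rewrite -big_split; apply: eq_bigr => i _ /=; rewrite ecoordD mulrDl.
Qed.

Lemma edotZl a x y : edot (a *: x) y = a * edot x y.
Proof. by rewrite mulr_sumr; apply: eq_bigr => i _; rewrite ecoordZ mulrA. Qed.

Lemma edotDr x y z : edot x (y + z) = edot x y + edot x z.
Proof. by rewrite edotC edotDl !(edotC x). Qed.

Lemma edotZr a x y : edot x (a *: y) = a * edot x y.
Proof. by rewrite edotC edotZl edotC. Qed.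

Lemma edot_ge0 x : 0 <= edot x x.
Proof. by apply: sumr_ge0 => i _; rewrite -expr2 sqr_ge0. Qed.

Lemma sqr_enorm x : enorm x ^+ 2 = edot x x.
Proof. by rewrite sqr_sqrtr// edot_ge0. Qed.

Lemma edot_eq0 x : edot x x = 0 -> x = 0.
Proof.
move=> /eqP; rewrite psumr_eq0 => [|i _]; last by rewrite -expr2 sqr_ge0.
move=> /allP x0; apply/ffunP => i; rewrite [RHS]ffunE.
by have := x0 i (mem_index_enum i); rewrite /= mulf_eq0 orbb => /eqP.
Qed.

Lemma enorm_eq0 x : enorm x = 0 -> x = 0.
Proof. by move=> x0; apply: edot_eq0; rewrite -sqr_enorm x0 expr0n. Qed.

Lemma enormZ a x : enorm (a *: x) = `|a| * enorm x.
Proof.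
by rewrite /enorm edotZl edotZr mulrA -expr2 sqrtrM ?sqr_ge0// sqrtr_sqr.
Qed.

Lemma edot_le x y : edot x y <= enorm x * enorm y.
Proof.
have nx0 : 0 <= enorm x by exact: sqrtr_ge0.
have ny0 : 0 <= enorm y by exact: sqrtr_ge0.
have [x0|xn0] := eqVneq (enorm x) 0.
  rewrite (enorm_eq0 x0) -[X in edot X](scale0r (0 : E)) edotZl mul0r.
  by rewrite mulr_ge0// sqrtr_ge0.
have [y0|yn0] := eqVneq (enorm y) 0.
  rewrite (enorm_eq0 y0) -[X in edot _ X](scale0r (0 : E)) edotZr mul0r.
  by rewrite mulr_ge0 ?sqrtr_ge0.
have := edot_ge0 (enorm y *: x + (- enorm x) *: y).
rewrite !(edotDl, edotDr, edotZl, edotZr) -!sqr_enorm (edotC y x) => H.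
have xy0 : 0 < enorm x * enorm y.
  by rewrite lt_neqAle eq_sym mulf_eq0 negb_or xn0 yn0 mulr_ge0.
rewrite -(ler_pM2l xy0); nra.
Qed.

Lemma enormD x y : enorm (x + y) <= enorm x + enorm y.
Proof.
rewrite -ler_sqr ?nnegrE ?addr_ge0 ?sqrtr_ge0// sqrrD !sqr_enorm.
rewrite edotDl !edotDr (edotC y x); have := edot_le x y; lra.
Qed.

HB.instance Definition _ :=
  Lmodule_isNormed.Build R E enormD enormZ enorm_eq0.

Lemma ecoord_le x i : `|ecoord x i| <= `|x|.
Proof.
rewrite -[leRHS]/(enorm x) -sqrtr_sqr ler_wsqrtr// /edot (bigD1 i)//= -expr2.
by rewrite lerDl sumr_ge0// => j _; rewrite -expr2 sqr_ge0.
Qed.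

Lemma enorm_le_sum x : `|x| <= \sum_i `|ecoord x i|.
Proof.
rewrite -[leLHS]/(enorm x) -ler_sqr ?nnegrE ?sqrtr_ge0 ?sumr_ge0//.
rewrite sqr_enorm expr2 mulr_suml /edot ler_sum// => i _.
rewrite (le_trans (ler_norm _))// normrM ler_wpM2l// (bigD1 i)//= lerDl.
by rewrite sumr_ge0.
Qed.

Lemma euclid_complete (F : set_system E) : ProperFilter F -> cauchy F -> cvg F.
Proof.
move=> FF /cauchy_ballP cF; apply/cvg_ex => /=.
have cFi i : cvg (ecoord^~ i @ F).
  apply: R_complete; apply/cauchy_ballP => e e0; near_simpl.
  have := cF e e0; apply: filterS => -[x y] /=.
  rewrite -!ball_normE /ball_ /=; apply: le_lt_trans.
  by rewrite -ecoordB; exact: ecoord_le.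
exists ([ffun i => lim (ecoord^~ i @ F)] : E).
apply/cvgrPdist_lt => e e0.
have n0 : 0 < (#|I|.+1%:R : R) by [].
have : \forall x \near F, forall i,
    `|lim (ecoord^~ i @ F) - ecoord x i| < e / #|I|.+1%:R.
  apply: filter_forall => i.
  by move/cvgrPdist_lt : (cFi i); apply; rewrite divr_gt0.
apply: filterS => x xl; rewrite (le_lt_trans (enorm_le_sum _))//.
apply: (@le_lt_trans _ _ (\sum_(i : I) e / #|I|.+1%:R)).
  apply: ler_sum => i _; rewrite (le_trans _ (ltW (xl i)))//.
  by rewrite ecoordB {1}/ecoord ffunE.
rewrite sumr_const -[_ *+ _]mulr_natr mulrAC ltr_pdivrMr// ltr_pM2l//.
by rewrite ltr_nat.
Unshelve. all: by end_near. Qed.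

HB.instance Definition _ := Uniform_isComplete.Build E euclid_complete.

Lemma edotxx x : edot x x = `|x| ^+ 2.
Proof. by rewrite -sqr_enorm. Qed.

HB.instance Definition _ :=
  CompleteNormedModule_isHilbert.Build R E edotC edotDl edotZl edotxx.

End euclid.

Section images.
Context {R : realType} {T : finType}.

(* Scalar images on the finite voxel set T, and triples of such images: the
   pair (x, j) indexes the value at voxel x of the j-th image. *)
Definition img : hilbertType R := euclid R T.
Definition img3 : hilbertType R := euclid R (T * 'I_3)%type.

Definition voxel_norm (w : img3) : img :=
  [ffun x => Num.sqrt (\sum_(j < 3) ecoord w (x, j) ^+ 2)].

Definition norm1 (u : img) : R := \sum_x `|ecoord u x|.

Definition norm21 (w : img3) : R := norm1 (voxel_norm w).

(* For lam > 0, the projection onto the w whose voxel norms are all <= lam. *)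
Definition Pi_lam (lam : R) (w : img3) : img3 :=
  [ffun p => ecoord w p / Num.max 1 (lam^-1 * ecoord (voxel_norm w) p.1)].

End images.

Arguments img : clear implicits.
Arguments img3 : clear implicits.

(* H 0 is arbitrary. *)
Definition is_heaviside {R : realType} (H : R -> R) :=
  (forall s, s < 0 -> H s = 0) /\ (forall s, 0 < s -> H s = 1).

(* Main.v *)
Require Import Defs.
From mathcomp Require Import all_boot all_order all_algebra.
From mathcomp Require Import all_classical all_reals all_analysis.
From mathcomp Require Import ring lra.

Import Order.TTheory GRing.Theory Num.Theory.
Import numFieldNormedType.Exports.

Local Open Scope classical_set_scope.
Local Open Scope ring_scope.

(** A function h with lam h = h for every
    lam > 0 is not rescaled in the primal update, so this update, and with it
    c2, does not depend on lam > 0 ([cv_primal_const]).  Hence w_{k+1} and the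
    dual prox with c2 frozen are the same function of the parameter near each
    lam > 0, and their derivatives agree wherever one of them exists.

    For g = ||.||_{2,1}, the conjugate of lam g is the indicator of the ball
    B = {||.||_{2,oo} <= lam} ([fenchel_norm21]): inside B the voxelwise
    Cauchy-Schwarz inequality bounds <u, w> by lam g(w), and outside B a
    multiple of u supported at one violating voxel makes <u, w> - lam g(w)
    arbitrarily large.  An indicator is unchanged by the factor sig, and its
    prox at c is the projection of c, which is recognised by the obtuse-angle
    inequality <c - p, v - p> <= 0 for v in B ([prox_indicator]).  Both B and
    the inner product split over voxels, so that inequality reduces to a single
    Euclidean ball, where the projection is the radial retraction [clip]
    ([clip_obtuse]).

    Finally, with n the norm of w at a voxel, a component of Pi_lam w is the
    constant w for lam > n and the linear function lam w / n for lam < n; these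
    have the stated derivatives ([is_derive_div_max]).  Only lam = n, a null
    set, is excluded. *)

(** * Prox of an indicator function *)

Lemma hdotDr {R : realType} {V : hilbertType R} (x y z : V) :
  hdot x (y + z) = hdot x y + hdot x z.
Proof. by rewrite hdotC hdotDl !(hdotC x). Qed.

Lemma hdotZr {R : realType} {V : hilbertType R} (a : R) (x y : V) :
  hdot x (a *: y) = a * hdot x y.
Proof. by rewrite hdotC hdotZl hdotC. Qed.

Lemma sqr_normD {R : realType} {V : hilbertType R} (x y : V) :
  `|x + y| ^+ 2 = `|x| ^+ 2 + 2 * hdot x y + `|y| ^+ 2.
Proof. by rewrite -!hdotxx hdotDl !hdotDr (hdotC y x); ring. Qed.

Lemma sqr_normB {R : realType} {V : hilbertType R} (x y : V) :
  `|x - y| ^+ 2 = `|x| ^+ 2 - 2 * hdot x y + `|y| ^+ 2.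
Proof. by rewrite sqr_normD -scaleN1r hdotZr scaleN1r normrN; ring. Qed.

Definition indicator {R : realType} {V : Type} (C : set V) (v : V) : \bar R :=
  (if `[< C v >] then 0 else +oo)%E.

(** Expanding |u - v|^2 around p, the obtuse-angle inequality gives
    |u - p|^2 + |v - p|^2 <= |u - v|^2 on C.  So p is a minimizer, and the term
    |v - p|^2 makes it the only one. *)
Lemma prox_indicator (R : realType) (V : hilbertType R) (C : set V) (u p : V) :
  C p -> (forall v, C v -> hdot (u - p) (v - p) <= 0) ->
  prox (indicator C) u = p.
Proof.
move=> Cp uCp.
have dist v : C v -> `|u - p| ^+ 2 + `|v - p| ^+ 2 <= `|u - v| ^+ 2.
  move=> Cv; have -> : u - v = (u - p) - (v - p) by rewrite opprB addrA subrK.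
  by rewrite (sqr_normB (u - p)); have := uCp v Cv; lra.
apply: xget_unique => [v|v /(_ p)]; rewrite /indicator (asboolT Cp) adde0.
  case: asboolP => [Cv|_]; last by rewrite leey.
  rewrite adde0 lee_fin ler_pM2l ?invr_gt0//.
  by have := dist v Cv; have := sqr_ge0 `|v - p|; lra.
case: asboolP => [Cv|_]; last by rewrite addey// leye_eq.
rewrite adde0 lee_fin ler_pM2l ?invr_gt0// => up.
apply/eqP; rewrite -subr_eq0 -normr_eq0 -sqrf_eq0 eq_le sqr_ge0 andbT.
by have := dist v Cv; lra.
Qed.

Lemma escale_indicator (R : realType) (V : Type) (c : R) (C : set V) :
  0 < c -> escale c (indicator C) = indicator C.
Proof.
move=> c0; apply/funext => v; rewrite /escale /indicator.
by case: ifP => _; rewrite ?mule0// gt0_muley// lte_fin.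
Qed.

(** * Projection onto a Euclidean ball *)

Lemma ecoord_inj {R : realType} {I : finType} {x y : euclid R I} :
  ecoord x =1 ecoord y -> x = y.
Proof. by move=> xy; apply/ffunP => i; exact: xy. Qed.

Lemma ecoord0 {R : realType} {I : finType} (i : I) :
  ecoord (0 : euclid R I) i = 0.
Proof. by rewrite /ecoord ffunE. Qed.

Lemma edotx0 {R : realType} {I : finType} (x : euclid R I) : edot x 0 = 0.
Proof. by rewrite /edot big1// => i _; rewrite ecoord0 mulr0. Qed.

Lemma enorm0 {R : realType} {I : finType} : enorm (0 : euclid R I) = 0.
Proof. by rewrite /enorm edotx0 sqrtr0. Qed.

Definition clip {R : realType} {I : finType} (r : R) (c : euclid R I) :
    euclid R I :=
  (Num.max 1 (r^-1 * enorm c))^-1 *: c.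

Lemma enorm_clip (R : realType) (I : finType) (r : R) (c : euclid R I) :
  0 < r -> enorm (clip r c) <= r.
Proof.
move=> r0; have m0 : 0 < Num.max 1 (r^-1 * enorm c) by rewrite lt_max ltr01.
rewrite enormZ gtr0_norm ?invr_gt0// mulrC ler_pdivrMr// -ler_pdivrMl//.
by rewrite le_max lexx orbT.
Qed.

(** With p the clipped vector and m >= 1 its divisor, c - p = (m - 1) p.  Either
    m = 1 and the left factor vanishes, or |p| = r and <p, v> <= r |v| <= |p|^2
    by Cauchy-Schwarz. *)
Lemma clip_obtuse (R : realType) (I : finType) (r : R) (c v : euclid R I) :
  0 < r -> enorm v <= r -> edot (c - clip r c) (v - clip r c) <= 0.
Proof.
move=> r0 vr; set m := Num.max 1 (r^-1 * enorm c); set p := clip r c.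
have m0 : 0 < m by rewrite lt_max ltr01.
have -> : c - p = (m - 1) *: p.
  by rewrite scalerBl scale1r scalerA divff ?gt_eqF// scale1r.
have [m1|m1] := leP (r^-1 * enorm c) 1.
  by rewrite /m (max_idPl m1) subrr edotZl mul0r.
have mE : m = r^-1 * enorm c by apply/max_idPr/ltW.
have pr : enorm p = r.
  rewrite enormZ gtr0_norm ?invr_gt0// -/m mE invfM invrK mulfVK//.
  by apply: contraTneq m1 => ->; rewrite mulr0 -leNgt ler01.
rewrite edotZl pmulr_rle0 ?subr_gt0 ?mE// edotDr -scaleN1r edotZr -sqr_enorm.
rewrite pr mulN1r subr_le0 (le_trans (edot_le _ _))// pr expr2.
by rewrite ler_pM2l.
Qed.

(** * The (2,1)-norm and its dual ball *)

Section voxels.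
Context {R : realType} {T : finType}.
Implicit Types (w v u : img3 R T) (x : T).

Definition voxel w x : euclid R 'I_3 := [ffun j => ecoord w (x, j)].

Lemma ecoord_voxel w x j : ecoord (voxel w x) j = ecoord w (x, j).
Proof. by rewrite /ecoord ffunE. Qed.

Lemma voxelB w v x : voxel (w - v) x = voxel w x - voxel v x.
Proof. by apply: ecoord_inj => j; rewrite ecoordB !ecoord_voxel ecoordB. Qed.

Lemma ecoord_voxel_norm w x : ecoord (voxel_norm w) x = enorm (voxel w x).
Proof.
rewrite {1}/ecoord ffunE /enorm /edot; congr Num.sqrt.
by apply: eq_bigr => j _; rewrite ecoord_voxel expr2.
Qed.

Lemma hdot_voxel w v : hdot w v = \sum_x edot (voxel w x) (voxel v x).
Proof.
rewrite -[LHS]/(edot w v) /edot pair_bigA /=.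
by apply: eq_bigr => -[x j] _; rewrite !ecoord_voxel.
Qed.

Lemma norm21E w : norm21 w = \sum_x enorm (voxel w x).
Proof.
by apply: eq_bigr => x _; rewrite ecoord_voxel_norm ger0_norm// sqrtr_ge0.
Qed.

Lemma voxel_Pi_lam lam w x : voxel (Pi_lam lam w) x = clip lam (voxel w x).
Proof.
apply: ecoord_inj => j; rewrite ecoordZ !ecoord_voxel {1}/ecoord ffunE /=.
by rewrite ecoord_voxel_norm mulrC.
Qed.

Definition ball2oo (lam : R) : set (img3 R T) :=
  [set w | forall x, enorm (voxel w x) <= lam].

Definition single_voxel x (c : euclid R 'I_3) : img3 R T :=
  [ffun p => if p.1 == x then ecoord c p.2 else 0].

Lemma voxel_single x c y : voxel (single_voxel x c) y = (y == x)%:R *: c.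
Proof.
apply: ecoord_inj => j; rewrite ecoordZ ecoord_voxel {1}/ecoord ffunE /=.
by case: eqP => _; rewrite ?mul1r ?mul0r.
Qed.

(** Evaluates at once the inner product with a single-voxel image and the norm
    of that image, both of which are sums over voxels. *)
Lemma sum_voxel_single (F : T -> euclid R 'I_3 -> R) x c :
  (forall y, F y 0 = 0) -> \sum_y F y (voxel (single_voxel x c) y) = F x c.
Proof.
move=> F0; rewrite (bigD1 x)//= voxel_single eqxx scale1r big1 ?addr0//.
move=> y /negPf yx; rewrite voxel_single yx scale0r; exact: F0.
Qed.

(** The conjugate of a multiple of a norm is the indicator of a dual ball; the
    dual norm of ||.||_{2,1} is ||.||_{2,oo}. *)
Lemma fenchel_norm21 (lam : R) : 0 < lam ->
  fenchel (escale lam (fun w : img3 R T => (norm21 w)%:E)) =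
  indicator (ball2oo lam).
Proof.
move=> lam0; apply/funext => u; rewrite /fenchel /indicator /escale.
case: asboolP => [ulam|/existsNP[x /negP]].
  apply/eqP; rewrite eq_le; apply/andP; split.
    apply: ub_ereal_sup => _ [w _ <-]; rewrite -EFinM -EFinB lee_fin subr_le0.
    rewrite hdot_voxel norm21E mulr_sumr; apply: ler_sum => x _.
    by rewrite (le_trans (edot_le _ _))// ler_wpM2r// sqrtr_ge0.
  apply: ereal_sup_ubound; exists 0 => //.
  have voxel0 x : voxel 0 x = 0.
    by apply: ecoord_inj => j; rewrite ecoord_voxel !ecoord0.
  rewrite -EFinM -EFinB hdot_voxel norm21E.
  by rewrite !big1 ?mulr0 ?subrr// => x _; rewrite voxel0 ?edotx0 ?enorm0.
rewrite -ltNge => lamu.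
set c := voxel u x in lamu.
have c0 : 0 < enorm c by exact: lt_trans lamu.
have d0 : 0 < enorm c * (enorm c - lam) by rewrite mulr_gt0 ?subr_gt0.
(* The test image k c at the voxel x has value k |c| (|c| - lam) = |t|. *)
apply/eq_infty => t; set k := `|t| / (enorm c * (enorm c - lam)).
have k0 : 0 <= k by rewrite divr_ge0// ltW.
apply: le_trans (ereal_sup_ubound _).
2: by exists (single_voxel x (k *: c)).
rewrite -EFinM -EFinB lee_fin hdot_voxel norm21E.
rewrite (sum_voxel_single (fun y => edot (voxel u y))); last first.
  by move=> y; exact: edotx0.
rewrite (sum_voxel_single (fun=> @enorm R 'I_3)); last first.
  by move=> y; exact: enorm0.
rewrite -/c edotZr enormZ -sqr_enorm (ger0_norm k0) /k.
rewrite (_ : _ - _ = `|t|) ?ler_norm//; field.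
by rewrite !gt_eqF ?subr_gt0.
Qed.

Lemma Pi_lam_ball lam w : 0 < lam -> ball2oo lam (Pi_lam lam w).
Proof. by move=> lam0 x; rewrite voxel_Pi_lam enorm_clip. Qed.

Lemma dual_prox_norm21 (sig lam : R) : 0 < sig -> 0 < lam ->
  dual_prox (fun v : img3 R T => (norm21 v)%:E) sig lam = Pi_lam lam.
Proof.
move=> sig0 lam0; apply/funext => c.
rewrite /dual_prox fenchel_norm21// escale_indicator//.
apply: prox_indicator => [|v vlam]; first exact: Pi_lam_ball.
rewrite hdot_voxel; apply: sumr_le0 => x _.
by rewrite !voxelB !voxel_Pi_lam clip_obtuse.
Qed.

End voxels.

(** * Derivatives with respect to the parameter *)

(** Away from mu = n the maximum is locally one of its two arguments: the
    function is a mu / n on the left of n and the constant a on the right. *)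
Lemma is_derive_div_max (R : realType) (H : R -> R) (a n lam : R) :
  is_heaviside H -> 0 <= n -> 0 < lam -> lam != n ->
  is_derive lam 1 (fun mu => a / Num.max 1 (mu^-1 * n) : R^o)
    (a * n / (lam ^+ 2 * Num.max 1 (lam^-1 * n) ^+ 2) * H (lam^-1 * n - 1)).
Proof.
move=> [Hlt0 Hgt0] n0 lam0; rewrite neq_lt => /orP[lamn|nlam].
  have n_gt0 : 0 < n by exact: lt_trans lamn.
  have lamn1 : 1 < lam^-1 * n by rewrite mulrC ltr_pdivlMr// mul1r.
  rewrite (max_idPr (ltW lamn1)) Hgt0 ?subr_gt0// mulr1.
  have -> : a * n / (lam ^+ 2 * (lam^-1 * n) ^+ 2) = a / n.
    by field; rewrite !gt_eqF.
  apply: (@near_eq_is_derive _ _ _ (fun mu => (a / n) *: (mu : R^o))).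
    near=> mu; have mu0 : 0 < mu by near: mu; exact: lt_nbhsr.
    have mun : mu < n by near: mu; exact: lt_nbhsl.
    rewrite (max_idPr _); last by rewrite mulrC ler_pdivlMr// mul1r ltW.
    by rewrite invfM invrK mulrA [LHS](mulrAC a).
  by apply: is_derive_eq; rewrite [_ *: _]mulr1.
have max1 mu : 0 < mu -> n < mu -> Num.max 1 (mu^-1 * n) = 1.
  by move=> mu0 nmu; apply/max_idPl; rewrite mulrC ler_pdivrMr// mul1r ltW.
rewrite Hlt0 ?mulr0; last by rewrite subr_lt0 mulrC ltr_pdivrMr// mul1r.
apply: (@near_eq_is_derive _ _ _ (cst (a : R^o))).
near=> mu; have nmu : n < mu by near: mu; exact: lt_nbhsr.
by rewrite max1 ?divr1//; exact: le_lt_trans nmu.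
Unshelve. all: by end_near. Qed.

(** The parameter enters the primal update only through gam lam h = h. *)
Lemma cv_primal_const (R : realType) (U W : hilbertType R) (f : U -> R^o)
    (h : U -> \bar R) (L : U -> W) (gam lam mu : R) (p : U * W) :
  (forall t, 0 < t -> escale t h = h) -> 0 < gam -> 0 < lam -> 0 < mu ->
  cv_primal f h L gam lam p = cv_primal f h L gam mu p.
Proof.
by move=> hE gam0 lam0 mu0; rewrite /cv_primal !hE ?mulr_gt0.
Qed.

Lemma ae_neq (R : realType) (a : R) :
  {ae @lebesgue_measure R, forall lam : R, lam != a}.
Proof.
exists [set a]; split; [exact: measurable_set1|exact: lebesgue_measure_set1|].
by move=> lam /negP; rewrite negbK => /eqP.
Qed.

Theorem proposition2 (R : realType) :
  (forall (U W : hilbertType R) (L : {linear U -> W}) (f : U -> R^o)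
      (g : W -> \bar R) (h : U -> \bar R) (beta gam sig : R),
    bounded_operator L ->
    convex_function (setT : set (convex_lmodType U)) f ->
    (forall u, differentiable f u) ->
    0 < beta -> beta.-lipschitz (gradient f) ->
    Gamma0 g -> Gamma0 h -> eproper (fun u => g (L u) + h u)%E ->
    (forall lam, 0 < lam -> exists u, is_argmin (objective f g h L lam) u) ->
    (forall lam, 0 < lam -> escale lam h = h) ->
    0 < gam -> 0 < sig ->
    forall p : U * W,
    let c2 lam := cv_c2 f h L gam sig lam p in
    let w lam := (cv_step f g h L gam sig lam p).2 in
    let prox_c c lam := dual_prox g sig lam c in
    {ae @lebesgue_measure R, forall lam : R, 0 < lam ->
       derivable (prox_c (c2 lam)) lam 1} ->
    {ae @lebesgue_measure R, forall lam : R, 0 < lam ->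
       derivable w lam 1 /\ derive1 w lam = derive1 (prox_c (c2 lam)) lam}) /\
  (forall (T : finType),
    (forall (sig lam : R), 0 < sig -> 0 < lam ->
      dual_prox (fun v : img3 R T => (norm21 v)%:E) sig lam = Pi_lam lam) /\
    (forall (H : R -> R) (w : img3 R T) (x : T), is_heaviside H ->
      {ae @lebesgue_measure R, forall lam : R, 0 < lam -> forall j : 'I_3,
        is_derive lam 1 (fun mu => ecoord (Pi_lam mu w) (x, j) : R^o)
          (ecoord w (x, j) * ecoord (voxel_norm w) x
             / (lam ^+ 2 * Num.max 1 (lam^-1 * ecoord (voxel_norm w) x) ^+ 2)
             * H (lam^-1 * ecoord (voxel_norm w) x - 1))})).

Proof.
split.
  move=> U W L f g h beta gam sig _ _ _ _ _ _ _ _ _ hE gam0 _ p c2 w prox_c.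
  apply: filterS; first exact: (ae_filter_ringOfSetsType lebesgue_measure).
  move=> lam der lam0.
  have weq : {near lam, prox_c (c2 lam) =1 w}.
    near=> mu; have mu0 : 0 < mu by near: mu; exact: lt_nbhsr.
    by rewrite /w /prox_c /c2 /cv_c2 /= (@cv_primal_const _ _ _ _ _ _ _ lam mu).
  split; first exact: near_eq_derivable weq (der lam0).
  by rewrite !derive1E; apply/esym/near_eq_derive.
move=> T; split; first exact: dual_prox_norm21.
move=> H w x HH; have := ae_neq _ (ecoord (voxel_norm w) x).
apply: filterS; first exact: (ae_filter_ringOfSetsType lebesgue_measure).
move=> lam lamn lam0 j.
have -> : (fun mu => ecoord (Pi_lam mu w) (x, j) : R^o) =
    (fun mu => ecoord w (x, j) / Num.max 1 (mu^-1 * ecoord (voxel_norm w) x)).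
  by apply/funext => mu; rewrite {1}/ecoord ffunE.
by apply: is_derive_div_max => //; rewrite ecoord_voxel_norm sqrtr_ge0.
Unshelve. all: by end_near. Qed.
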